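(* Let $(X,\mathbb{A},d)$ be a $C^{\ast}$-algebra valued metric space and let $C_{x_0,r}^{C^{\ast}}$ be any circle on $X$ (with $x_0\in X$, $r\in\mathbb{A}_+$). Define $\varphi:X\to\mathbb{A}_+$ by $\varphi(x)=d(x,x_0)$ for all $x\in X$. Let $T:X\to X$ be a self-mapping satisfying $$d(x,Tx)\preceq \varphi(x)+\varphi(Tx)-2r\qquad\text{and}\qquad d(Tx,x_0)\preceq r$$ for all $x\in C_{x_0,r}^{C^{\ast}}$. If $T$ satisfies the contraction condition $$d(Tx,Ty)\preceq A\left(d(Tx,y)+d(Ty,x)\right)$$ for all $x\in C_{x_0,r}^{C^{\ast}}$, $y\in X\setminus C_{x_0,r}^{C^{\ast}}$ and some $A\in\mathbb{A}_+^{\prime}$ with $\|A\|<\frac12$, then the circle $C_{x_0,r}^{C^{\ast}}$ is the unique fixed circle of $T$.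
   Context: $\mathbb{A}$ is a unital $C^{\ast}$-algebra with unit $I$ and zero element $\theta$. $\mathbb{A}_h=\{a\in\mathbb{A}: a=a^{\ast}\}$. An element $a\in\mathbb{A}$ is positive, written $\theta\preceq a$, if $a\in\mathbb{A}_h$ and its spectrum is contained in $[0,\infty)$; $\mathbb{A}_+$ is the set of positive elements (so $\theta\in\mathbb{A}_+$). For $a,b\in\mathbb{A}_h$, $a\preceq b$ means $b-a\in\mathbb{A}_+$. $\mathbb{A}^{\prime}=\{a\in\mathbb{A}: ab=ba\text{ for all }b\in\mathbb{A}\}$ and $\mathbb{A}_+^{\prime}=\mathbb{A}_+\cap\mathbb{A}^{\prime}$. A $C^{\ast}$-algebra valued metric space $(X,\mathbb{A},d)$ is a nonempty set $X$ with a map $d:X\times X\to\mathbb{A}$ such that for all $x,y,z\in X$: (i) $\theta\preceq d(x,y)$, and $d(x,y)=\theta$ if and only if $x=y$; (ii) $d(x,y)=d(y,x)$; (iii) $d(x,y)\preceq d(x,z)+d(z,y)$. For $x_0\in X$ and $r\in\mathbb{A}_+$, the circle with center $x_0$ and radius $r$ is $C_{x_0,r}^{C^{\ast}}=\{x\in X: d(x,x_0)=r\}$. For a self-mapping $T:X\to X$, the circle $C_{x_0,r}^{C^{\ast}}$ is called a fixed circle of $T$ if $Tx=x$ for all $x\in C_{x_0,r}^{C^{\ast}}$. The element $A$ in the contraction condition is the same for all $x,y$.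
   Formalization: Literal uniqueness fails (points of the circle give fixed circles of radius zero, and smaller fixed circles can lie inside it), so ''unique'' is read as: if the circle is nonempty, every fixed circle of T is contained in it. *)

(* Defs.v *)
From HB Require Import structures.
From mathcomp Require Import all_boot all_order all_algebra.
From mathcomp Require Import complex.
From mathcomp Require Import all_classical all_reals.

Set Implicit Arguments.
Unset Strict Implicit.
Unset Printing Implicit Defensive.
Import Order.TTheory GRing.Theory Num.Theory.
Local Open Scope classical_set_scope.
Local Open Scope ring_scope.

(* The norm is a field of the mixin, rather than inherited from
   [completeNormedModType R[i]], because Hierarchy-Builder refuses a join of
   the normed modules with the (noncommutative) rings: [numDomainType] already
   is a structure above both.  Nonnegativity of the norm follows from
   [cnormD] and [cnormZ].

   Basing the structure on [unitAlgType] costs no generality apart from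
   [1 != 0]: classically every nonzero unital algebra carries such a structure,
   and [GRing.unit] is two-sided invertibility. *)
HB.mixin Record isUnitalCStarAlgebra (R : realType) A
    of GRing.UnitAlgebra R[i] A := {
  cnorm : A -> R;
  star : A -> A;
  cnorm0_eq0 : forall a : A, cnorm a = 0 -> a = 0;
  cnormD : forall a b : A, cnorm (a + b) <= cnorm a + cnorm b;
  cnormZ : forall (k : R[i]) (a : A), cnorm (k *: a) = Normc.normc k * cnorm a;
  cnormM : forall a b : A, cnorm (a * b) <= cnorm a * cnorm b;
  cnorm_complete : forall u : nat -> A,
    (forall e : R, 0 < e -> exists N : nat, forall m n : nat,
       (N <= m)%N -> (N <= n)%N -> cnorm (u m - u n) < e) ->
    exists l : A, forall e : R, 0 < e -> exists N : nat, forall n : nat,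
       (N <= n)%N -> cnorm (u n - l) < e;
  starD : forall a b : A, star (a + b) = star a + star b;
  starZ : forall (k : R[i]) (a : A), star (k *: a) = k^* *: star a;
  starM : forall a b : A, star (a * b) = star b * star a;
  starK : forall a : A, star (star a) = a;
  cnorm_star : forall a : A, cnorm (star a * a) = cnorm a ^+ 2
}.

#[short(type="unitalCStarAlgType")]
HB.structure Definition UnitalCStarAlgebra (R : realType) :=
  {A of GRing.UnitAlgebra R[i] A & isUnitalCStarAlgebra R A}.

Section CStarAlgebra.
Context {R : realType} {A : unitalCStarAlgType R}.
Implicit Types a b : A.

Definition selfadjoint a : Prop := star a = a.

Definition spectrum a : set R[i] :=
  [set l | a - l%:A \isn't a GRing.unit].

(* In the order of [R[i]], [0 <= l] says that [l] lies in the real half-line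
   [0, +oo). *)
Definition cstar_pos a : Prop :=
  selfadjoint a /\ spectrum a `<=` [set l | 0 <= l].

(* Meant for self-adjoint [a] and [b]. *)
Definition cstar_le a b : Prop := cstar_pos (b - a).

Definition central a : Prop := forall b, a * b = b * a.

Definition cstar_metric (X : Type) (d : X -> X -> A) : Prop :=
  [/\ inhabited X,
      forall x y, cstar_pos (d x y) /\ (d x y = 0 <-> x = y),
      forall x y, d x y = d y x
    & forall x y z, cstar_le (d x y) (d x z + d z y)].

Definition circle (X : Type) (d : X -> X -> A) (x0 : X) (r : A) : set X :=
  [set x | d x x0 = r].

Definition fixed_circle (X : Type) (d : X -> X -> A) (T : X -> X)
    (x0 : X) (r : A) : Prop :=
  forall x, circle d x0 r x -> T x = x.

(* "Unique" cannot mean that every fixed circle equals the given one as a set: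
   if [x1] is fixed by [T] then [circle d x1 0] is [{x1}], a fixed circle, and
   an empty circle is fixed vacuously.  Uniqueness means that no fixed circle
   has a point outside the given one.  It is claimed for nonempty circles only,
   since emptiness makes every hypothesis quantified over the circle vacuous. *)
Definition unique_fixed_circle (X : Type) (d : X -> X -> A) (T : X -> X)
    (x0 : X) (r : A) : Prop :=
  fixed_circle d T x0 r /\
  (circle d x0 r !=set0 ->
   forall (x1 : X) (rho : A), cstar_pos rho -> fixed_circle d T x1 rho ->
     circle d x1 rho `<=` circle d x0 r).

End CStarAlgebra.

(* Main.v *)
Require Import Defs.
From HB Require Import structures.
From mathcomp Require Import all_boot all_order all_algebra.
From mathcomp Require Import complex.
From mathcomp Require Import all_classical all_reals.
From mathcomp Require Import ring lra.

Set Implicit Arguments.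
Unset Strict Implicit.
Import Order.TTheory GRing.Theory Num.Theory.
Local Open Scope classical_set_scope.
Local Open Scope ring_scope.

(** On the circle the two hypotheses add up to [- d x (T x)] being positive,
    and [d x (T x)] is positive, so [T x = x].  If [y] is fixed by [T] but off
    the circle and [x] is on it, the contraction condition reads
    [D <= a * (D + D)] with [D := d x y]; hence [cnorm D <= 2 cnorm a cnorm D]
    with [2 cnorm a < 1], so [D = 0] and [x = y], which is absurd.

    Three facts on positivity are used: positive elements are closed under
    sums ([cstar_posD]), only [0] is positive together with its opposite
    ([cstar_posN_eq0]), and the norm is monotone on positive elements
    ([cnorm_monotone]).  As positivity is spectral, all three rest on
    [cnorm_spectrum]: the norm of a self-adjoint element, up to sign, lies in
    its spectrum.  From it one gets the metric description of positivity,
    [cnorm (t - a) <= t] for [t >= cnorm a], which sums obviously preserve.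

    [cnorm_spectrum] is proved without complex analysis, in the manner of
    Rickart.  Let [b] be self-adjoint of norm [1], with neither [1] nor [-1] in
    its spectrum.  The spectrum of [b] is real (Arens) and the resolvent is
    explicitly bounded off the real axis, so it is bounded on the unit circle
    ([resolvent_bound_circle]).  For [s < 1] close to [1], the resolvents of
    [b] and [s b] are therefore uniformly close on the unit circle.  The
    partial fraction identity

      [1 / (b^2 - m^2) = (1 / (b - m) - 1 / (b + m)) / (2 m)]

    shows that the same bound holds for the squares ([circle_close_sqr]), hence
    for all powers with exponent [2 ^ k].  Closeness of resolvents bounds the
    distance of [b ^+ (2 ^ k)] and [s ^+ (2 ^ k) b ^+ (2 ^ k)] by [1/4]; but
    the first has norm [1] by the C*-identity and the second tends to [0]. *)

(** * Preliminaries on scalars and units *)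

Lemma expr_lt_eps (F : archiRealFieldType) (q e : F) :
  0 <= q -> q < 1 -> 0 < e -> exists n : nat, q ^+ n < e.
Proof.
move=> q0 q1 e0.
(* Bernoulli's inequality for q^-1, in a form without inverses *)
have bern n : q ^+ n * (1 + n%:R * (1 - q)) <= 1.
  elim: n => [|n IHn]; first by rewrite expr0 mul0r addr0 mulr1.
  have qn0 : 0 <= q ^+ n by rewrite exprn_ge0.
  apply: le_trans IHn; rewrite exprSr -mulrA ler_wpM2l //.
  rewrite -natr1; have n0 : 0 <= n%:R :> F := ler0n _ _.
  have := mulr_ge0 n0 (sqr_ge0 (1 - q)); have := sqr_ge0 (1 - q); nra.
have d0 : 0 < 1 - q by rewrite subr_gt0.
have ei0 : 0 < e^-1 by rewrite invr_gt0.
exists (Num.bound (e^-1 / (1 - q))); set n := Num.bound _.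
have := archi_boundP (ltW (divr_gt0 ei0 d0)); rewrite -/n ltr_pdivrMr // => hn.
have pos : 0 < 1 + n%:R * (1 - q) by rewrite ltr_wpDr // mulr_ge0 // ltW.
have := bern n; rewrite -ler_pdivlMr // mul1r => /le_lt_trans; apply.
rewrite invf_plt ?posrE //; lra.
Qed.

Lemma inv_sub (U : unitRingType) (x y : U) :
  x \is a GRing.unit -> y \is a GRing.unit ->
  x^-1 - y^-1 = x^-1 * (y - x) * y^-1.
Proof. by move=> ux uy; rewrite mulrBr mulrBl mulVr // mul1r mulrK. Qed.

Section Scalars.
Context {R : realType}.
Implicit Types (x : R) (l : R[i]).
Local Notation normc := Normc.normc.

Lemma normc_real x : normc (x%:C)%C = `|x|.
Proof. by rewrite /= expr0n addr0 sqrtr_sqr. Qed.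

Lemma normc_ge0 l : 0 <= normc l.
Proof. by case: l => x y; apply: sqrtr_ge0. Qed.

Lemma sqr_normc_conj l : ((normc l ^+ 2)%:C)%C = l * l^*.
Proof. by rewrite -normCK rmorphXn. Qed.

End Scalars.

(** * Norm, involution and the Neumann series *)

Section Norm.
Context {R : realType} {A : unitalCStarAlgType R}.
Implicit Types (a b x : A) (l : R[i]).
Local Notation normc := Normc.normc.

Lemma cnorm0 : cnorm (0 : A) = 0.
Proof. by rewrite -(scale0r (0 : A)) cnormZ Normc.normc0 mul0r. Qed.

Lemma cnormN a : cnorm (- a) = cnorm a.
Proof. by rewrite -scaleN1r cnormZ normcN Normc.normc1 mul1r. Qed.

Lemma cnorm_ge0 a : 0 <= cnorm a.
Proof. by have := cnormD a (- a); rewrite subrr cnorm0 cnormN; lra. Qed.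

Lemma cnorm_eq0 a : (cnorm a == 0) = (a == 0).
Proof. by apply/eqP/eqP => [/cnorm0_eq0|->] //; rewrite cnorm0. Qed.

Lemma cnormB a b : cnorm (a - b) = cnorm (b - a).
Proof. by rewrite -opprB cnormN. Qed.

Lemma cnorm_scale_real (s : R) a : cnorm ((s%:C)%C *: a) = `|s| * cnorm a.
Proof. by rewrite cnormZ normc_real. Qed.

Lemma star0 : star (0 : A) = 0.
Proof. by rewrite -{1}(scale0r (0 : A)) starZ conjC0 scale0r. Qed.

Lemma starN a : star (- a) = - star a.
Proof. by apply/eqP; rewrite -subr_eq0 opprK -starD addNr star0. Qed.

Lemma starB a b : star (a - b) = star a - star b.
Proof. by rewrite starD starN. Qed.

Lemma star1 : star (1 : A) = 1.
Proof. by rewrite -[RHS](starK 1) -[star 1 in RHS]mul1r starM starK mul1r. Qed.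

Lemma star_scalar l : star (l%:A : A) = (l^*)%:A.
Proof. by rewrite starZ star1. Qed.

Lemma cnorm1 : cnorm (1 : A) = 1.
Proof.
have := cnorm_star (1 : A); rewrite star1 mulr1 expr2 => h.
have n0 : cnorm (1 : A) != 0 by rewrite cnorm_eq0 oner_neq0.
by apply: (mulfI n0); rewrite -h mulr1.
Qed.

Lemma cnorm_scalar l : cnorm (l%:A : A) = normc l.
Proof. by rewrite cnormZ cnorm1 mulr1. Qed.

Lemma cnorm_starE a : cnorm (star a) = cnorm a.
Proof.
have le b : cnorm b <= cnorm (star b).
  have [->|b0] := eqVneq b 0; first by rewrite cnorm0 cnorm_ge0.
  have p : 0 < cnorm b by rewrite lt_def cnorm_ge0 cnorm_eq0 b0.
  by rewrite -(ler_pM2r p) -expr2 -cnorm_star cnormM.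
by apply/eqP; rewrite eq_le le -{2}(starK a) le.
Qed.

Lemma cnorm_sqr b : selfadjoint b -> cnorm (b * b) = cnorm b ^+ 2.
Proof. by move=> sb; rewrite -cnorm_star sb. Qed.

Lemma cnormX a n : cnorm (a ^+ n) <= cnorm a ^+ n.
Proof.
elim: n => [|n IHn]; first by rewrite !expr0 cnorm1.
rewrite !exprS (le_trans (cnormM _ _)) // ler_wpM2l ?cnorm_ge0 //.
Qed.

Lemma star_unit x : x \is a GRing.unit -> star x \is a GRing.unit.
Proof.
move=> ux; apply/unitrP; exists (star x^-1).
by rewrite -!starM mulVr ?mulrV ?star1.
Qed.

Lemma starV x : x \is a GRing.unit -> star x^-1 = (star x)^-1.
Proof.
move=> ux; apply: (mulrI (star_unit ux)).
by rewrite mulrV ?star_unit // -starM mulVr ?star1.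
Qed.

(** The inverse is the sum of the geometric series, whose partial sums are
    Cauchy; this is the only use of completeness. *)
Lemma neumann_unit x : cnorm x < 1 -> 1 - x \is a GRing.unit.
Proof.
set q := cnorm x => q1; have q0 : 0 <= q := cnorm_ge0 x.
pose u n : A := \sum_(i < n) x ^+ i.
have uE n : (1 - x) * u n = 1 - x ^+ n.
  by rewrite -opprB mulNr -subrX1 opprB.
have uEr n : u n * (1 - x) = 1 - x ^+ n.
  rewrite -uE; apply/commr_sym.
  apply: commr_sum => i _; apply: commrX; apply: commr_sym.
  by apply: commrB; [apply: commr1 | apply: commr_refl].
have uS m : u m.+1 = u m + x ^+ m by rewrite /u big_ord_recr.
(* the factor 1 - q is kept on the left so that the bound telescopes *)
have step n k : cnorm (u (n + k)%N - u n) * (1 - q) <= q ^+ n.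
  elim: k n => [|k IHk] n.
    by rewrite addn0 subrr cnorm0 mul0r exprn_ge0.
  have -> : u (n + k.+1)%N - u n = (u (n.+1 + k)%N - u n.+1) + x ^+ n.
    by rewrite addnS addSn (uS n) opprD addrA subrK.
  have h1 := cnormD (u (n.+1 + k)%N - u n.+1) (x ^+ n).
  have h2 := IHk n.+1; rewrite exprS in h2.
  have h3 := cnormX x n; rewrite -/q in h3.
  nra.
have tail n m : (n <= m)%N -> cnorm (u m - u n) * (1 - q) <= q ^+ n.
  by move=> nm; rewrite -(subnKC nm).
have dec n m : (n <= m)%N -> q ^+ m <= q ^+ n.
  by move=> nm; rewrite ler_wiXn2l // ltW.
have [l hl] : exists l : A, forall e : R, 0 < e ->
    exists N : nat, forall n : nat, (N <= n)%N -> cnorm (u n - l) < e.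
  apply: cnorm_complete => e e0.
  have [|N hN] := @expr_lt_eps R q (e * (1 - q)) q0 q1.
    by rewrite mulr_gt0 ?subr_gt0.
  exists N => m n Nm Nn.
  wlog nm : m n Nm Nn / (n <= m)%N => [W|].
    have [nm|/ltnW mn] := leqP n m; first exact: W.
    by rewrite cnormB; apply: W.
  have qq : 0 < 1 - q by rewrite subr_gt0.
  rewrite -(ltr_pM2r qq); apply: le_lt_trans (tail _ _ nm) _.
  exact: le_lt_trans (dec _ _ Nn) hN.
have close (z : A) : (forall e : R, 0 < e -> cnorm z < e) -> z = 0.
  move=> h; apply/eqP; rewrite -cnorm_eq0 eq_le cnorm_ge0 andbT leNgt.
  by apply/negP => /h; rewrite ltxx.
have main e : 0 < e -> exists n, cnorm (u n - l) * (1 + q) + q ^+ n < e.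
  move=> e0; have e20 : 0 < e / 4 by lra.
  have [N1 h1] := hl _ e20; have [N2 h2] := expr_lt_eps q0 q1 e20.
  exists (maxn N1 N2); have := h1 _ (leq_maxl N1 N2).
  have := dec _ _ (leq_maxr N1 N2).
  have := cnorm_ge0 (u (maxn N1 N2) - l); nra.
have n1x : cnorm (1 - x) <= 1 + q.
  by apply: le_trans (cnormD _ _) _; rewrite cnorm1 cnormN.
apply/unitrP; exists l; split; apply/eqP; rewrite -subr_eq0; apply/eqP;
  apply: close => e /main [n]; apply: le_lt_trans.
- have -> : l * (1 - x) - 1 = - ((u n - l) * (1 - x) + x ^+ n).
    by rewrite mulrBl uEr addrAC subrK opprB.
  rewrite cnormN (le_trans (cnormD _ _)) // lerD ?cnormX //.
  by rewrite (le_trans (cnormM _ _)) // ler_wpM2l ?cnorm_ge0.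
- have -> : (1 - x) * l - 1 = - ((1 - x) * (u n - l) + x ^+ n).
    by rewrite mulrBr uE addrAC subrK opprB.
  rewrite cnormN (le_trans (cnormD _ _)) // lerD ?cnormX //.
  by rewrite (le_trans (cnormM _ _)) // mulrC ler_wpM2l ?cnorm_ge0.
Qed.

End Norm.

(** * Spectrum and resolvent of self-adjoint elements *)

Section Spectrum.
Context {R : realType} {A : unitalCStarAlgType R}.
Implicit Types (a b : A) (l m : R[i]).
Local Notation normc := Normc.normc.

Definition resolvent b l : A := (b - l%:A)^-1.

Lemma spectrum_le_cnorm a l : spectrum a l -> normc l <= cnorm a.
Proof.
rewrite /spectrum /= leNgt => /negP nu; apply/negP => lta; apply: nu.
have nl0 : 0 < normc l by apply: le_lt_trans lta; apply: cnorm_ge0.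
have l0 : l != 0 by apply: contraTneq nl0 => ->; rewrite Normc.normc0 ltxx.
have -> : a - l%:A = - l *: (1 - l^-1 *: a).
  by rewrite scalerBr scalerA mulNr mulfV // scaleN1r scaleNr opprK addrC.
rewrite scaler_unit ?unitfE ?oppr_eq0 //; apply: neumann_unit.
by rewrite cnormZ Normc.normcV mulrC ltr_pdivrMr // mul1r.
Qed.

Lemma spectrumN a l : spectrum (- a) l <-> spectrum a (- l).
Proof. by rewrite /spectrum /= scaleNr opprK -opprD unitrN. Qed.

Lemma spectrum_shift a l m : spectrum (l%:A - a) m <-> spectrum a (l - m).
Proof.
rewrite /spectrum /= -unitrN.
suff -> : - (l%:A - a - m%:A) = a - (l - m)%:A by [].
by rewrite scalerBl addrAC opprB.
Qed.

Lemma selfadjoint_scalar (s : R) : selfadjoint ((s%:C)%C%:A : A).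
Proof.
by rewrite /selfadjoint star_scalar; congr (_ *: _); apply: conjc_real.
Qed.

Lemma selfadjointD a b : selfadjoint a -> selfadjoint b -> selfadjoint (a + b).
Proof. by rewrite /selfadjoint starD => -> ->. Qed.

Lemma selfadjointB a b : selfadjoint a -> selfadjoint b -> selfadjoint (a - b).
Proof. by rewrite /selfadjoint starB => -> ->. Qed.

(** Arens' trick: translate so that the spectral point is [i t].  Then for every
    real [m] the point [i (t + m)] is in the spectrum of [c + i m], whose
    squared norm is at most [cnorm c ^+ 2 + m ^+ 2] by the C*-identity; thus
    [t ^+ 2 + 2 t m <= cnorm c ^+ 2], which a suitable [m] contradicts. *)
Lemma spectrum_real b l : selfadjoint b -> spectrum b l -> complex.Im l = 0.
Proof.
move=> sb; case: l => s t hl /=; apply/eqP; apply: contraPT (hl) => t0.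
pose c := b - (s%:C)%C%:A.
have sc : selfadjoint c by apply: selfadjointB sb (selfadjoint_scalar s).
pose m := cnorm c ^+ 2 / t.
have hsp : spectrum (c + (0 +i* m)%C%:A) (0 +i* (t + m))%C.
  move: hl; rewrite /spectrum /=.
  suff -> : c + (0 +i* m)%C%:A - (0 +i* (t + m))%C%:A = b - (s +i* t)%C%:A.
    by [].
  rewrite /c -!scaleNr -!addrA -!scalerDl; congr (_ + _ *: _).
  by apply/eqP; rewrite eq_complex /=; apply/andP; split; apply/eqP; ring.
(* from here on only the self-adjointness of c matters; with its body visible,
   distributivity would expand c as a sum *)
move: c sc @m hsp => c sc m hsp.
have := spectrum_le_cnorm hsp.
have nE : normc (0 +i* (t + m))%C = `|t + m|.
  by rewrite /= expr0n add0r sqrtr_sqr.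
have sE : star (c + (0 +i* m)%C%:A) * (c + (0 +i* m)%C%:A)
    = c * c + ((m ^+ 2)%:C)%C%:A.
  rewrite starD sc star_scalar.
  have -> : ((0 +i* m)%C^*)%:A = - ((0 +i* m)%C%:A : A).
    rewrite -scaleNr; congr (_ *: _); apply/eqP.
    by rewrite eq_complex /= oppr0 !eqxx.
  rewrite mulrDl !mulrDr !mulNr !mulr_algl mulr_algr addrA addrK.
  rewrite scalerA -scaleNr.
  congr (_ + _ *: _).
  by apply/eqP; rewrite eq_complex /=; apply/andP; split; apply/eqP; ring.
rewrite nE -(ler_pXn2r (n := 2)) ?nnegrE ?cnorm_ge0 // -cnorm_star sE => h _.
move: (le_trans h (cnormD _ _)).
rewrite cnorm_sqr // cnorm_scalar normc_real real_normK ?num_real //.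
rewrite ger0_norm ?sqr_ge0 // => {}h.
have mE : t * m = cnorm c ^+ 2 by rewrite /m mulrCA mulfV // mulr1.
have t2 : 0 < t ^+ 2 by rewrite exprn_even_gt0.
suff : t ^+ 2 <= 0 by rewrite leNgt t2.
have := sqr_ge0 (cnorm c); nra.
Qed.

(** Let [r] be the resolvent and [k := l - l^*].  The resolvent identity gives
    [r - star r = k r (star r)]; the bound follows by taking norms and applying
    the C*-identity to the right-hand side. *)
Lemma resolvent_conj_bound b l : selfadjoint b -> b - l%:A \is a GRing.unit ->
  normc (l - l^*) * cnorm (resolvent b l) <= 2.
Proof.
move=> sb ub; rewrite /resolvent; set w := b - l%:A; set r := w^-1.
have sw : star w = b - (l^*)%:A by rewrite starB sb star_scalar.
have dw : star w - w = (l - l^*)%:A.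
  by rewrite sw /w opprB scalerBl [LHS]addrC addrA subrK.
have E : r - star r = (l - l^*) *: (r * star r).
  by rewrite /r starV // inv_sub ?star_unit // dw mulr_algr -scalerAl.
have n1 : cnorm (r * star r) = cnorm r ^+ 2.
  by rewrite -{1}(starK r) cnorm_star cnorm_starE.
have := cnormD r (- star r); rewrite E cnormZ n1 cnormN cnorm_starE => h.
have r0 : 0 < cnorm r.
  rewrite lt_def cnorm_ge0 cnorm_eq0 andbT.
  by apply: contraTneq ub => r0; rewrite -unitrV -/r r0 unitr0.
by rewrite -(ler_pM2r r0) -mulrA -expr2; lra.
Qed.

Lemma resolvent_sub_points b l m :
  b - l%:A \is a GRing.unit -> b - m%:A \is a GRing.unit ->
  resolvent b l - resolvent b m = (l - m) *: (resolvent b m * resolvent b l).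
Proof.
move=> ul um; apply: oppr_inj.
rewrite opprB -scaleNr opprB /resolvent inv_sub //.
have -> : b - l%:A - (b - m%:A) = (m - l)%:A.
  by rewrite opprB scalerBl addrC addrA subrK.
by rewrite mulr_algr -scalerAl.
Qed.

(** By the resolvent identity, the norm of the resolvent at most doubles near
    a regular point; the radius [1 / (2 C)] depends only on the bound [C]. *)
Lemma resolvent_near b l m (C : R) :
  b - l%:A \is a GRing.unit -> b - m%:A \is a GRing.unit ->
  cnorm (resolvent b m) <= C -> normc (l - m) * C <= 2^-1 ->
  cnorm (resolvent b l) <= 2 * C.
Proof.
move=> ul um hm hC.
have E : resolvent b l =
    resolvent b m + (l - m) *: (resolvent b m * resolvent b l).
  by rewrite -resolvent_sub_points // addrC subrK.
have := cnormD (resolvent b m) ((l - m) *: (resolvent b m * resolvent b l)).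
rewrite -E cnormZ => h.
have h2 := cnormM (resolvent b m) (resolvent b l).
have := cnorm_ge0 (resolvent b l); have := normc_ge0 (l - m).
set x := cnorm (resolvent b m) in h h2 hm *.
set y := cnorm (resolvent b l) in h h2 *.
set t := cnorm (_ * _) in h h2; set n := normc _ in h hC *.
move=> n0 y0; have : n * t <= n * (C * y).
  by rewrite ler_wpM2l // (le_trans h2) // ler_wpM2r.
have : n * C * y <= 2^-1 * y by rewrite ler_wpM2r.
lra.
Qed.

(** On the unit circle [l - l^* = (l - 1) (l + 1) / l], so a point far from both
    [1] and [-1] is far from the real axis, where [resolvent_conj_bound]
    applies; near [1] and [-1] the value there controls the resolvent. *)
Lemma resolvent_bound_circle b : selfadjoint b ->
  ~ spectrum b 1 -> ~ spectrum b (- 1) ->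
  exists2 C : R, 1 <= C & forall l, normc l = 1 ->
    b - l%:A \is a GRing.unit /\ cnorm (resolvent b l) <= C.
Proof.
move=> sb /negP; rewrite negbK => u1 /negP; rewrite negbK => uN1.
set C1 := cnorm (resolvent b 1) + cnorm (resolvent b (-1)) + 1.
have p1 := cnorm_ge0 (resolvent b 1).
have pN1 := cnorm_ge0 (resolvent b (-1)).
have C11 : 1 <= C1 by rewrite /C1; lra.
have C10 : 0 < C1 by lra.
exists (8 * C1 ^+ 2) => [|l nl]; first by nra.
have ul : b - l%:A \is a GRing.unit.
  apply: contraT => hl; have Il := spectrum_real sb hl.
  case: l nl hl Il => s t /= nl hl t0; move: nl hl.
  rewrite t0 expr0n addr0 sqrtr_sqr => /eqP.
  rewrite eqr_norml ler01 andbT => /orP[] /eqP ->; first by rewrite u1.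
  have -> : ((-1) +i* 0)%C = -1 :> R[i].
    by apply/eqP; rewrite eq_complex /= oppr0 !eqxx.
  by rewrite uN1.
split=> //.
have [h1|h1] := leP (normc (l - 1) * C1) 2^-1.
  apply: le_trans (resolvent_near ul u1 _ h1) _; first by rewrite /C1; lra.
  nra.
have [h2|h2] := leP (normc (l - (-1)) * C1) 2^-1.
  apply: le_trans (resolvent_near ul uN1 _ h2) _; first by rewrite /C1; lra.
  nra.
(* multiplying by l, of modulus 1, turns l - l^* into l ^+ 2 - 1 *)
have E : normc (l - l^*) = normc (l - 1) * normc (l - (-1)).
  rewrite -Normc.normcM -[normc (l - l^*)]mul1r -nl -Normc.normcM.
  by rewrite mulrBr -sqr_normc_conj nl expr1n; congr normc; ring.
have := resolvent_conj_bound sb ul; rewrite E.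
have := cnorm_ge0 (resolvent b l).
set x := normc (l - 1) in h1 *; set y := normc (l - -1) in h2 *.
set t := cnorm (resolvent b l).
move=> t0 h.
have hh : 2^-1 * 2^-1 <= (x * C1) * (y * C1).
  by apply: ler_pM; rewrite ?invr_ge0 ?ler0n ?(ltW h1) ?(ltW h2).
have : 2^-1 * 2^-1 * t <= (x * C1) * (y * C1) * t by rewrite ler_wpM2r.
have : x * y * t * C1 ^+ 2 <= 2 * C1 ^+ 2 by rewrite ler_wpM2r ?sqr_ge0.
nra.
Qed.

End Spectrum.

(** * The norm of a self-adjoint element is attained on its spectrum *)

Section SpectralRadius.
Context {R : realType} {A : unitalCStarAlgType R}.
Implicit Types (b c : A) (l m : R[i]) (e : R).
Local Notation normc := Normc.normc.

Lemma resolvent_sub_elements b c l :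
  b - l%:A \is a GRing.unit -> c - l%:A \is a GRing.unit ->
  resolvent b l - resolvent c l = resolvent b l * (c - b) * resolvent c l.
Proof.
by move=> ub uc; rewrite /resolvent inv_sub // opprB addrA subrK.
Qed.

(** The partial fraction identity behind [circle_close_sqr]. *)
Lemma resolvent_sqr b m : m != 0 ->
  b - m%:A \is a GRing.unit -> b - (- m)%:A \is a GRing.unit ->
  b ^+ 2 - (m ^+ 2)%:A \is a GRing.unit /\
  resolvent (b ^+ 2) (m ^+ 2)
    = (m *+ 2)^-1 *: (resolvent b m - resolvent b (- m)).
Proof.
move=> m0 u1 u2.
have m20 : m *+ 2 != 0 by rewrite mulrn_eq0.
have E1 : b ^+ 2 - (m ^+ 2)%:A = (b - m%:A) * (b - (- m)%:A).
  rewrite scaleNr opprK mulrBl !mulrDr mulr_algl mulr_algr mulr_algl scalerA.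
  by rewrite opprD addrA addrK.
have E2 : b ^+ 2 - (m ^+ 2)%:A = (b - (- m)%:A) * (b - m%:A).
  rewrite scaleNr opprK mulrDl !mulrBr mulr_algl mulr_algr mulr_algl scalerA.
  by rewrite addrA subrK.
have u : b ^+ 2 - (m ^+ 2)%:A \is a GRing.unit by rewrite E1 unitrMl.
split=> //; apply: (mulrI u); rewrite {1}/resolvent mulrV // -scalerAr mulrBr.
rewrite {1}E2 {1}E1 /resolvent !mulrK // opprB addrC addrA subrK.
by rewrite -scalerBl opprK scalerA mulVf // scale1r.
Qed.

(** A uniform bound on the unit circle is what survives squaring, because the
    square roots of points of the unit circle are again on it. *)
Definition circle_close e b c : Prop :=
  forall l, normc l = 1 ->
    [/\ b - l%:A \is a GRing.unit, c - l%:A \is a GRing.unit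
      & cnorm (resolvent b l - resolvent c l) <= e].

(** Each resolvent of the squares is the half difference of two resolvents, up
    to a factor of modulus [1], so the bound [e] does not deteriorate. *)
Lemma circle_close_sqr e b c :
  circle_close e b c -> circle_close e (b ^+ 2) (c ^+ 2).
Proof.
move=> h l nl; pose m := sqrtc l.
have lE : l = m ^+ 2 by rewrite /m sqr_sqrtc.
have nm : normc m = 1.
  have : normc m ^+ 2 = 1 by rewrite expr2 -Normc.normcM -expr2 -lE.
  move/eqP; rewrite sqrf_eq1 => /orP[/eqP //|/eqP E].
  by have := normc_ge0 m; rewrite E lerNr oppr0 ler10.
have nNm : normc (- m) = 1 by rewrite normcN.
have m0 : m != 0.
  by apply: contra_eq_neq nm => ->; rewrite Normc.normc0 eq_sym oner_neq0.
have [b1 c1 h1] := h _ nm; have [b2 c2 h2] := h _ nNm.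
have [ub Eb] := resolvent_sqr m0 b1 b2; have [uc Ec] := resolvent_sqr m0 c1 c2.
rewrite lE; split=> //; rewrite Eb Ec -scalerBr cnormZ Normc.normcV normcMn nm.
rewrite mulrC ler_pdivrMr ?ltr0n // opprB [X in cnorm (_ + X)]addrC addrACA.
apply: le_trans (cnormD _ _) _; rewrite mulr_natr mulr2n; apply: lerD => //.
by rewrite addrC cnormB.
Qed.

(** The resolvent identity at the point [1] recovers [c - b] from the difference
    of the resolvents, with two outer factors of norm at most [2]. *)
Lemma circle_close_cnorm e b c :
  circle_close e b c -> cnorm b <= 1 -> cnorm c <= 1 -> cnorm (b - c) <= 4 * e.
Proof.
move=> h nb nc; have [|ub uc he] := h 1; first exact: Normc.normc1.
have E : c - b = (b - 1%:A) * (resolvent b 1 - resolvent c 1) * (c - 1%:A).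
  by rewrite resolvent_sub_elements // /resolvent !mulrA mulrV // mul1r mulrVK.
have two (x : A) : cnorm x <= 1 -> cnorm (x - 1%:A) <= 2.
  move=> nx; apply: le_trans (cnormD _ _) _.
  by rewrite cnormN cnorm_scalar Normc.normc1; lra.
rewrite cnormB E; have := two _ nb; have := two _ nc.
set x := b - 1%:A; set y := c - 1%:A; set d := _ - _ in he *.
move=> ny nx; apply: le_trans (cnormM _ _) _.
have h1 : cnorm (x * d) <= 2 * e.
  by apply: le_trans (cnormM _ _) _; apply: ler_pM; rewrite ?cnorm_ge0.
apply: (@le_trans _ _ (2 * e * 2)); last lra.
by apply: ler_pM; rewrite ?cnorm_ge0.
Qed.

(** The factor is at distance [dl = 1 / (32 C^2)] from [1]: then [C dl <= 1/2],
    which bounds the resolvent of the scaled element by [2 C], and the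
    resolvents differ by at most [C * dl * (2 C) = 1/16]. *)
Lemma circle_close_scale b : cnorm b = 1 ->
  forall C : R, 1 <= C ->
  (forall l, normc l = 1 ->
    b - l%:A \is a GRing.unit /\ cnorm (resolvent b l) <= C) ->
  circle_close (16^-1) b ((1 - (32 * C ^+ 2)^-1)%:C%C *: b).
Proof.
move=> nb C C1 hC l nl.
set dl := (32 * C ^+ 2)^-1.
have C2 : 1 <= C ^+ 2 by nra.
have dlE : dl * (32 * C ^+ 2) = 1 by rewrite mulVf //; apply: lt0r_neq0; lra.
have dl0 : 0 < dl by rewrite invr_gt0; lra.
have dlh : dl * C <= 2^-1 by nra.
have dl1 : dl < 1 by nra.
have [ub hb] := hC l nl.
set c := _ *: b.
have uc : c - l%:A \is a GRing.unit.
  apply: contraT => /spectrum_le_cnorm; rewrite nl /c cnorm_scale_real nb.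
  rewrite ger0_norm; lra.
have ncb : cnorm (c - b) = dl.
  rewrite /c -{2}(scale1r b) -scalerBl -(rmorph1 (real_complex R)) -rmorphB /=.
  rewrite cnorm_scale_real nb mulr1 addrC addrA addNr add0r normrN ger0_norm //.
  exact: ltW.
split=> //; have E := resolvent_sub_elements ub uc.
set D := cnorm (resolvent b l - resolvent c l).
have hD : D <= C * dl * cnorm (resolvent c l).
  rewrite /D E; apply: le_trans (cnormM _ _) _; apply: ler_wpM2r.
    exact: cnorm_ge0.
  apply: le_trans (cnormM _ _) _; rewrite ncb.
  by apply: ler_wpM2r => //; exact: ltW.
have hc : cnorm (resolvent c l) <= C + D.
  have -> : resolvent c l = resolvent b l - (resolvent b l - resolvent c l).
    by rewrite opprB addrC subrK.
  by apply: le_trans (cnormD _ _) _; rewrite cnormN lerD.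
have c0 := cnorm_ge0 (resolvent c l).
have hc2 : cnorm (resolvent c l) <= 2 * C.
  have : C * dl * cnorm (resolvent c l) <= 2^-1 * cnorm (resolvent c l).
    by apply: ler_wpM2r => //; rewrite mulrC.
  lra.
apply: le_trans hD _.
have : C * dl * cnorm (resolvent c l) <= C * dl * (2 * C).
  by apply: ler_wpM2l => //; apply: mulr_ge0; lra.
lra.
Qed.

(** Otherwise [b ^+ (2 ^ k)], of norm [1] for all [k], would stay within
    [4 / 16] of its multiple by [s ^+ (2 ^ k)], which tends to [0]. *)
Lemma cnorm1_spectrum b : selfadjoint b -> cnorm b = 1 ->
  spectrum b 1 \/ spectrum b (- 1).
Proof.
move=> sb nb; apply: contrapT => /not_orP[h1 h2].
have [C C1 hC] := resolvent_bound_circle sb h1 h2.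
have := circle_close_scale nb C1 hC.
set s := 1 - _ => h.
have C2 : 0 < 32 * C ^+ 2 by nra.
have s1 : s < 1 by rewrite ltrBlDr ltrDl invr_gt0.
have s0 : 0 <= s by rewrite subr_ge0 invf_le1 //; nra.
have iter k : [/\ circle_close 16^-1 (b ^+ (2 ^ k)) ((s%:C%C *: b) ^+ (2 ^ k)),
    selfadjoint (b ^+ (2 ^ k)) & cnorm (b ^+ (2 ^ k)) = 1].
  elim: k => [|k [hk sk nk]]; first by rewrite expn0 !expr1.
  rewrite expnSr !exprM; split.
  - exact: circle_close_sqr.
  - by rewrite /selfadjoint expr2 starM sk.
  - by rewrite expr2 cnorm_sqr // nk expr1n.
have [n hn] := @expr_lt_eps R s 2^-1 s0 s1 (ltac:(lra)).
have hN : s ^+ (2 ^ n) < 2^-1.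
  apply: le_lt_trans hn; apply: ler_wiXn2l => //; [exact: ltW|].
  exact/ltnW/ltn_expl.
have [cl _ n1] := iter n.
rewrite exprZn -rmorphXn in cl.
set t := s ^+ (2 ^ n) in hN cl; set d := b ^+ _ in n1 cl.
have t0 : 0 <= t by rewrite exprn_ge0.
have := circle_close_cnorm cl.
rewrite n1 cnorm_scale_real n1 mulr1 ger0_norm //.
move=> /(_ (lexx _)) /(_ (ltac:(lra))).
rewrite -{1}(scale1r d) -scalerBl -(rmorph1 (real_complex R)) -rmorphB /=.
rewrite cnorm_scale_real n1 mulr1 ger0_norm; lra.
Qed.

Lemma cnorm_spectrum b : selfadjoint b ->
  spectrum b (cnorm b)%:C%C \/ spectrum b (- (cnorm b)%:C%C).
Proof.
move=> sb; have [->|b0] := eqVneq b 0.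
  left; rewrite /spectrum /= cnorm0 rmorph0 scale0r subr0 unitr0 //.
have n0 : cnorm b != 0 by rewrite cnorm_eq0.
set k := (cnorm b)%:C%C.
have k0 : k != 0 by rewrite /k; apply: contra n0 => /eqP [->].
have n1 : cnorm (k^-1 *: b) = 1.
  by rewrite cnormZ Normc.normcV normc_real ger0_norm ?cnorm_ge0 ?mulVf.
have s1 : selfadjoint (k^-1 *: b).
  rewrite /selfadjoint starZ sb fmorphV; congr (_^-1 *: _); exact: conjc_real.
have sc l : spectrum (k^-1 *: b) l -> spectrum b (k * l).
  rewrite /spectrum /= -(@scaler_unit _ _ k) ?unitfE //.
  by rewrite scalerBr !scalerA mulfV // scale1r.
by case: (cnorm1_spectrum s1 n1) => /sc; rewrite ?mulrN mulr1; [left|right].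
Qed.

End SpectralRadius.

(** * Positive elements *)

Section Positive.
Context {R : realType} {A : unitalCStarAlgType R}.
Implicit Types (a b : A) (t : R).

Lemma cstar_pos_selfadjoint a : cstar_pos a -> selfadjoint a.
Proof. by case. Qed.

Lemma cstar_pos_spectrum a t : cstar_pos a -> spectrum a t%:C%C -> 0 <= t.
Proof. by move=> [_ h] /h; rewrite /= ler0c. Qed.

Lemma cstar_posP a : selfadjoint a ->
  (forall t, spectrum a t%:C%C -> 0 <= t) -> cstar_pos a.
Proof.
move=> sa h; split=> // -[s t] hl /=; have /= t0 := spectrum_real sa hl.
by move: hl; rewrite t0 => /h; rewrite -ler0c.
Qed.

Lemma cstar_posN_eq0 a : cstar_pos a -> cstar_pos (- a) -> a = 0.
Proof.
move=> pa pNa; apply: cnorm0_eq0; apply/eqP; rewrite eq_le cnorm_ge0 andbT.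
rewrite -oppr_ge0; have [] := cnorm_spectrum (cstar_pos_selfadjoint pa).
  rewrite -[_%:C%C]opprK -spectrumN -rmorphN; exact: cstar_pos_spectrum.
by rewrite -rmorphN; apply: cstar_pos_spectrum.
Qed.

(** Together with [cstar_pos_shift], this expresses positivity by the norm. That
    makes sums of positive elements tractable: their spectra are unrelated to
    those of the summands, but norms satisfy the triangle inequality. *)
Lemma cnorm_shift_le a t : cstar_pos a -> cnorm a <= t ->
  cnorm (t%:C%C%:A - a) <= t.
Proof.
move=> pa nt; have sa := cstar_pos_selfadjoint pa.
have t0 : 0 <= t := le_trans (cnorm_ge0 _) nt.
have := cnorm_ge0 (t%:C%C%:A - a).
have [] := cnorm_spectrum (selfadjointB (selfadjoint_scalar t) sa);
  rewrite -?rmorphN spectrum_shift -rmorphB /= => h n0.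
  by have := cstar_pos_spectrum pa h; rewrite subr_ge0.
have := spectrum_le_cnorm h; rewrite normc_real => /(le_trans (ler_norm _)).
lra.
Qed.

Lemma cstar_pos_shift a t : selfadjoint a -> cnorm (t%:C%C%:A - a) <= t ->
  cstar_pos a.
Proof.
move=> sa nt; apply: cstar_posP => // s hs.
have : spectrum (t%:C%C%:A - a) (t - s)%:C%C.
  by rewrite spectrum_shift -rmorphB /= opprB addrC subrK.
move/spectrum_le_cnorm; rewrite normc_real => /(le_trans (ler_norm _)).
lra.
Qed.

Lemma cstar_posD a b : cstar_pos a -> cstar_pos b -> cstar_pos (a + b).
Proof.
move=> pa pb; apply: (@cstar_pos_shift _ (cnorm a + cnorm b)).
  by apply: selfadjointD; apply: cstar_pos_selfadjoint.
rewrite rmorphD scalerDl opprD addrACA.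
by apply: le_trans (cnormD _ _) _; apply: lerD; apply: cnorm_shift_le.
Qed.

Lemma cstar_pos_cnorm_sub a :
  selfadjoint a -> cstar_pos ((cnorm a)%:C%C%:A - a).
Proof.
move=> sa; apply: (@cstar_pos_shift _ (cnorm a)).
  exact: selfadjointB (selfadjoint_scalar _) sa.
by rewrite opprB addrC subrK.
Qed.

(** If [a <= b] then [a <= cnorm b], so that [cnorm a], a point of the spectrum
    of [a], is at most [cnorm b]. *)
Lemma cnorm_monotone a b : cstar_pos a -> cstar_le a b -> cnorm a <= cnorm b.
Proof.
rewrite /cstar_le => pa pab; have sa := cstar_pos_selfadjoint pa.
have sb : selfadjoint b.
  rewrite -(subrK a b); apply: selfadjointD => //.
  exact: cstar_pos_selfadjoint.
have := cstar_posD (cstar_pos_cnorm_sub sb) pab; rewrite addrA subrK => pna.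
have [h|] := cnorm_spectrum sa.
  suff : spectrum ((cnorm b)%:C%C%:A - a) (cnorm b - cnorm a)%:C%C.
    by move/(cstar_pos_spectrum pna); rewrite subr_ge0.
  by rewrite spectrum_shift -rmorphB /= opprB addrC subrK.
rewrite -rmorphN /= => /(cstar_pos_spectrum pa); rewrite oppr_ge0 => h.
exact: le_trans h (cnorm_ge0 _).
Qed.

End Positive.

(** * The unique fixed circle *)

Theorem theorem10 (R : realType) (A : unitalCStarAlgType R) (X : Type)
    (d : X -> X -> A) (hd : cstar_metric d)
    (x0 : X) (r : A) (hr : cstar_pos r)
    (phi : X -> A) (hphi : forall x, phi x = d x x0)
    (T : X -> X)
    (hT1 : forall x, circle d x0 r x ->
       cstar_le (d x (T x)) (phi x + phi (T x) - r *+ 2))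
    (hT2 : forall x, circle d x0 r x -> cstar_le (d (T x) x0) r)
    (hcontr : exists a : A,
       [/\ cstar_pos a, central a, cnorm a < 1 / 2
         & forall x y, circle d x0 r x -> ~ circle d x0 r y ->
             cstar_le (d (T x) (T y)) (a * (d (T x) y + d (T y) x))]) :
  unique_fixed_circle d T x0 r.
Proof.
case: hd => _ dpos dsym _.
have fixed : fixed_circle d T x0 r.
  move=> x hx; apply/esym/(dpos x (T x)).2.
  have [pd _] := dpos x (T x); apply: cstar_posN_eq0 => //.
  have := cstar_posD (hT1 x hx) (hT2 x hx); rewrite /cstar_le !hphi hx.
  suff -> : r + d (T x) x0 - r *+ 2 - d x (T x) + (r - d (T x) x0)
            = - d x (T x) by [].
  have -> : r + d (T x) x0 - r *+ 2 = d (T x) x0 - r.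
    by rewrite mulr2n opprD addrACA subrr add0r.
  by rewrite addrAC -(opprB (d (T x) x0) r) subrr add0r.
split=> // -[x hx] x1 rho _ fix1 y hy; apply: contrapT => ny.
case: hcontr => a [_ _ na /(_ x y hx ny)]; rewrite fixed // fix1 // (dsym y x).
have [pd eqd] := dpos x y; move/(cnorm_monotone pd) => h.
suff d0 : d x y = 0 by apply: ny; rewrite -(eqd.1 d0).
apply: cnorm0_eq0; have := le_trans h (cnormM _ _).
have := cnormD (d x y) (d x y); have := cnorm_ge0 (d x y).
have := cnorm_ge0 a.
set n := cnorm (d x y); set k := cnorm a in na *; set w := cnorm _.
move=> k0 n0 h1 h2; apply/eqP; rewrite eq_le n0 andbT.
have : k * w <= k * (n + n) by apply: ler_wpM2l.
nra.
Qed.
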